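(* Let $(M,T) \models \mathrm{CT}^-$, let $c \in M$, and let $(\alpha_i)_{i\leq c}$, $(\beta_i)_{i\leq c}$ be coded sequences in $M$ of arithmetical sentences of $M$. Suppose that the least $k_0$ such that $(M,T) \models T \alpha_{k_0}$ exists and is a standard natural number. Then $$(M,T) \models T\Big(\bigvee_{i=0}^{c,\alpha} \beta_i\Big) \equiv T \beta_{k_0}.$$
   Context: $\mathrm{PA}$ is formulated in the language $\mathcal{L}_{\mathrm{PA}}$ with $0$, successor $S$, $+$, $\times$; syntax is arithmetised (Gödel coding), so ''formula/sentence of $M$'' means an element of $M$ that $M$ thinks is (the code of) an arithmetical formula/sentence, possibly nonstandard. $\mathrm{CT}^-$ is the theory in $\mathcal{L}_{\mathrm{PA}}\cup\{T\}$ ($T$ unary) consisting of the axioms of $\mathrm{PA}$ (induction only for arithmetical formulae) plus: (1) for all closed terms $s,t$: $T(s=t) \leftrightarrow \mathrm{val}(s)=\mathrm{val}(t)$; (2) for all sentences $\phi$: $T(\neg\phi)\leftrightarrow \neg T\phi$; (3) for all sentences $\phi,\psi$: $T(\phi\vee\psi)\leftrightarrow T\phi\vee T\psi$; (4) for every variable $v$ and formula $\phi$ with at most $v$ free: $T(\exists v\phi)\leftrightarrow \exists x\, T\phi[\underline{x}/v]$, where $\underline{x}$ is the numeral $S\cdots S0$ ($x$ times); (5) (regularity) for every formula $\phi$ and sequences $\bar s,\bar t$ of closed terms with equal sequences of values: $T\phi(\bar t)\leftrightarrow T\phi(\bar s)$. Connectives $\wedge$ and $\rightarrow$ are the usual abbreviations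 via $\neg,\vee$. The disjunction with stopping condition is defined inside $M$ by backward recursion on $a\le c$: $\bigvee_{i=c}^{c,\alpha}\beta_i = (\alpha_c\wedge\beta_c)$, and for $a<c$, $\bigvee_{i=a}^{c,\alpha}\beta_i = (\alpha_a\rightarrow\beta_a)\wedge[(\alpha_a\wedge\beta_a)\vee(\neg\alpha_a\wedge \bigvee_{i=a+1}^{c,\alpha}\beta_i)]$. *)

(* Defs.v *)
Set Implicit Arguments.
Unset Strict Implicit.
Unset Printing Implicit Defensive.

(** * Structures for the language of arithmetic *)

Record structure : Type := Structure {
  carrier :> Type;
  zero : carrier;
  succ : carrier -> carrier;
  add : carrier -> carrier -> carrier;
  mul : carrier -> carrier -> carrier
}.

Arguments zero {_}.
Arguments succ {_} _.
Arguments add {_} _ _.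
Arguments mul {_} _ _.

Declare Scope pa_scope.
Delimit Scope pa_scope with pa.
Notation "x + y" := (add x y) : pa_scope.
Notation "x * y" := (mul x y) : pa_scope.
Local Open Scope pa_scope.

(** * Peano arithmetic

    The (external) first-order syntax is needed only to express the
    induction scheme.  The scheme below quantifies over all valuations [e],
    i.e. it allows parameters from the model. *)

Inductive term : Type :=
| tVar (v : nat)
| tZero
| tSucc (t : term)
| tAdd (t u : term)
| tMul (t u : term).

Inductive form : Type :=
| fEq (t u : term)
| fNot (p : form)
| fOr (p q : form)
| fEx (v : nat) (p : form).

Definition upd {X : Type} (e : nat -> X) (v : nat) (x : X) : nat -> X :=
  fun w => if Nat.eqb w v then x else e w.

Fixpoint eval {M : structure} (e : nat -> M) (t : term) : M :=
  match t with
  | tVar v => e v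
  | tZero => zero
  | tSucc t => succ (eval e t)
  | tAdd t u => eval e t + eval e u
  | tMul t u => eval e t * eval e u
  end.

Fixpoint sat {M : structure} (e : nat -> M) (p : form) : Prop :=
  match p with
  | fEq t u => eval e t = eval e u
  | fNot p => ~ sat e p
  | fOr p q => sat e p \/ sat e q
  | fEx v p => exists x : M, sat (upd e v x) p
  end.

Record PA (M : structure) : Prop := {
  PA_succ_inj : forall x y : M, succ x = succ y -> x = y;
  PA_succ_neq0 : forall x : M, succ x <> zero;
  PA_add0 : forall x : M, x + zero = x;
  PA_addS : forall x y : M, x + succ y = succ (x + y);
  PA_mul0 : forall x : M, x * zero = zero;
  PA_mulS : forall x y : M, x * succ y = x * y + x;
  PA_ind : forall (p : form) (v : nat) (e : nat -> M),
    sat (upd e v zero) p ->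
    (forall x, sat (upd e v x) p -> sat (upd e v (succ x)) p) ->
    forall x, sat (upd e v x) p
}.

(** * Arithmetised syntax

    Everything from here on is evaluated inside a structure [M].  Each
    relation on [M] below is the interpretation in [M] of an arithmetical
    formula: apart from parameters, it is built from the operations of [M],
    equality, connectives and quantifiers over [M] only.  Thus [Form x] says
    that [M] thinks that [x] codes a formula, [x] being possibly
    nonstandard. *)

Definition le {M : structure} (x y : M) : Prop := exists z, x + z = y.
Definition lt {M : structure} (x y : M) : Prop := le (succ x) y.

(** The standard elements of [M] are the [std n]. *)
Fixpoint std {M : structure} (n : nat) : M :=
  match n with
  | O => zero
  | S n => succ (std n)
  end.

(** An injective polynomial, since
    (x + y)^2 <= pair x y < (x + y + 1)^2. *)
Definition pair {M : structure} (x y : M) : M := (x + y) * (x + y) + x.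

(** [entry s i x]: the [i]-th entry of the coded sequence [s] is [x], by
    Goedel's beta function: [s] is a pair of [a] and [b], and [x] is the
    remainder of [a] modulo 1 + (i + 1) b.  In a model of PA, [x] is unique,
    and every [s] that is a pair has an [i]-th entry for all [i]; a sequence
    of a given length is obtained by looking at initial entries only. *)
Definition entry {M : structure} (s i x : M) : Prop :=
  exists a b q : M,
    s = pair a b /\
    a = q * succ (succ i * b) + x /\
    lt x (succ (succ i * b)).

(** Inductive definitions inside [M]: [derivable Step x] means that there is
    a coded sequence whose last entry is [x], in which every entry [y]
    satisfies [Step R y], where [R] holds of the earlier entries.  If [Step]
    is arithmetical then so is [derivable Step]. *)
Definition derivable {M : structure}
    (Step : (M -> Prop) -> M -> Prop) (x : M) : Prop :=
  exists s n : M,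
    entry s n x /\
    forall i y, le i n -> entry s i y ->
      Step (fun z => exists j, lt j i /\ entry s j z) y.

(** ** Codes of terms and formulas *)

Definition cVar {M : structure} (v : M) : M := pair (std 0) v.
Definition cZero {M : structure} : M := pair (std 1) zero.
Definition cSucc {M : structure} (t : M) : M := pair (std 2) t.
Definition cAdd {M : structure} (t u : M) : M := pair (std 3) (pair t u).
Definition cMul {M : structure} (t u : M) : M := pair (std 4) (pair t u).

Definition cEq {M : structure} (t u : M) : M := pair (std 5) (pair t u).
Definition cNot {M : structure} (p : M) : M := pair (std 6) p.
Definition cOr {M : structure} (p q : M) : M := pair (std 7) (pair p q).
Definition cEx {M : structure} (v p : M) : M := pair (std 8) (pair v p).

Definition cAnd {M : structure} (p q : M) : M := cNot (cOr (cNot p) (cNot q)).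
Definition cImp {M : structure} (p q : M) : M := cOr (cNot p) q.

Definition Term {M : structure} (x : M) : Prop :=
  derivable (fun R x =>
    (exists v, x = cVar v) \/
    x = cZero \/
    (exists t, R t /\ x = cSucc t) \/
    (exists t u, R t /\ R u /\ x = cAdd t u) \/
    (exists t u, R t /\ R u /\ x = cMul t u)) x.

Definition ClTerm {M : structure} (x : M) : Prop :=
  derivable (fun R x =>
    x = cZero \/
    (exists t, R t /\ x = cSucc t) \/
    (exists t u, R t /\ R u /\ x = cAdd t u) \/
    (exists t u, R t /\ R u /\ x = cMul t u)) x.

Definition Form {M : structure} (x : M) : Prop :=
  derivable (fun R x =>
    (exists t u, Term t /\ Term u /\ x = cEq t u) \/
    (exists p, R p /\ x = cNot p) \/
    (exists p q, R p /\ R q /\ x = cOr p q) \/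
    (exists v p, R p /\ x = cEx v p)) x.

(** [Occurs v t]: the variable [v] occurs in the term [t]. *)
Definition Occurs {M : structure} (v t : M) : Prop :=
  derivable (fun R x =>
    x = cVar v \/
    (exists t, R t /\ x = cSucc t) \/
    (exists t u, (R t \/ R u) /\ x = cAdd t u) \/
    (exists t u, (R t \/ R u) /\ x = cMul t u)) t.

(** [Free v p]: the variable [v] occurs free in the formula [p]. *)
Definition Free {M : structure} (v p : M) : Prop :=
  derivable (fun R x =>
    (exists t u, (Occurs v t \/ Occurs v u) /\ x = cEq t u) \/
    (exists p, R p /\ x = cNot p) \/
    (exists p q, (R p \/ R q) /\ x = cOr p q) \/
    (exists u p, u <> v /\ R p /\ x = cEx u p)) p.

Definition Sent {M : structure} (p : M) : Prop :=
  Form p /\ forall v, ~ Free v p.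

(** [Val t x]: the closed term [t] has value [x]. *)
Definition Val {M : structure} (t x : M) : Prop :=
  derivable (fun R z =>
    z = pair cZero zero \/
    (exists t x, R (pair t x) /\ z = pair (cSucc t) (succ x)) \/
    (exists t u x y, R (pair t x) /\ R (pair u y) /\
       z = pair (cAdd t u) (x + y)) \/
    (exists t u x y, R (pair t x) /\ R (pair u y) /\
       z = pair (cMul t u) (x * y))) (pair t x).

(** [Numeral x t]: [t] is the numeral S...S0 with [x] occurrences of S. *)
Definition Numeral {M : structure} (x t : M) : Prop :=
  derivable (fun R z =>
    z = pair zero cZero \/
    (exists x t, R (pair x t) /\ z = pair (succ x) (cSucc t))) (pair x t).

(** ** Substitution *)

(** [TSubst v s t t']: replacing [v] by [s] in the term [t] gives [t']. *)
Definition TSubst {M : structure} (v s t t' : M) : Prop :=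
  derivable (fun R z =>
    z = pair (cVar v) s \/
    (exists u, u <> v /\ z = pair (cVar u) (cVar u)) \/
    z = pair cZero cZero \/
    (exists t t', R (pair t t') /\ z = pair (cSucc t) (cSucc t')) \/
    (exists t t' u u', R (pair t t') /\ R (pair u u') /\
       z = pair (cAdd t u) (cAdd t' u')) \/
    (exists t t' u u', R (pair t t') /\ R (pair u u') /\
       z = pair (cMul t u) (cMul t' u'))) (pair t t').

(** [Subst v s p p']: replacing the free occurrences of [v] by [s] in the
    formula [p] gives [p'].  Bound variables are not renamed; this is used
    for closed [s] only, where no capture can occur. *)
Definition Subst {M : structure} (v s p p' : M) : Prop :=
  derivable (fun R z =>
    (exists t t' u u', TSubst v s t t' /\ TSubst v s u u' /\
       z = pair (cEq t u) (cEq t' u')) \/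
    (exists p p', R (pair p p') /\ z = pair (cNot p) (cNot p')) \/
    (exists p p' q q', R (pair p p') /\ R (pair q q') /\
       z = pair (cOr p q) (cOr p' q')) \/
    (exists p, z = pair (cEx v p) (cEx v p)) \/
    (exists u p p', u <> v /\ R (pair p p') /\
       z = pair (cEx u p) (cEx u p'))) (pair p p').

(** [SubstSeq n vs ts p p']: substituting the entries of [ts] for those of
    [vs], both sequences of length [n], in [p] gives [p'].  For closed terms
    and distinct variables, simultaneous substitution is the same as
    substitution one variable at a time, which is what is coded here. *)
Definition SubstSeq {M : structure} (n vs ts p p' : M) : Prop :=
  exists w : M,
    entry w zero p /\ entry w n p' /\
    forall i, lt i n ->
      exists v t q q', entry vs i v /\ entry ts i t /\
        entry w i q /\ entry w (succ i) q' /\ Subst v t q q'.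

(** [s] and [t] are sequences of closed terms of length [n] with equal
    sequences of values. *)
Definition SameVals {M : structure} (n ss ts : M) : Prop :=
  forall i, lt i n ->
    exists s t x, entry ss i s /\ entry ts i t /\
      ClTerm s /\ ClTerm t /\ Val s x /\ Val t x.

(** * The theory of compositional truth *)

(** [CTminus M T] says that [(M, T)] is a model of CT^-.  Induction is
    available only for arithmetical formulas, as [T] is not in the language
    of [PA]. *)
Record CTminus (M : structure) (T : M -> Prop) : Prop := {
  CT_PA : PA M;
  CT_eq : forall s t : M, ClTerm s -> ClTerm t ->
    (T (cEq s t) <-> exists x, Val s x /\ Val t x);
  CT_not : forall p : M, Sent p -> (T (cNot p) <-> ~ T p);
  CT_or : forall p q : M, Sent p -> Sent q ->
    (T (cOr p q) <-> T p \/ T q);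
  CT_ex : forall v p : M, Form p -> (forall u, Free u p -> u = v) ->
    (T (cEx v p) <-> exists x n q, Numeral x n /\ Subst v n p q /\ T q);
  CT_reg : forall p n vs ss ts ps pt : M,
    Form p ->
    (forall i j v, lt i n -> lt j n -> entry vs i v -> entry vs j v -> i = j) ->
    (forall v, Free v p -> exists i, lt i n /\ entry vs i v) ->
    SameVals n ss ts ->
    SubstSeq n vs ss p ps -> SubstSeq n vs ts p pt ->
    (T pt <-> T ps)
}.

(** * Disjunctions with a stopping condition *)

(** [s] codes a sequence, indexed by [i <= c], of sentences of [M]. *)
Definition SentSeq {M : structure} (c s : M) : Prop :=
  forall i, le i c -> exists p, entry s i p /\ Sent p.

Definition stopStep {M : structure} (a b d : M) : M :=
  cAnd (cImp a b) (cOr (cAnd a b) (cAnd (cNot a) d)).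

(** [StopDisj alpha beta c a d]: [d] is the disjunction of the [beta_i] for
    [i] from [a] to [c] with stopping condition [alpha].  The backward
    recursion is witnessed by a coded sequence [w] whose entries at the
    indices from [a] to [c] are the intermediate disjunctions. *)
Definition StopDisj {M : structure} (alpha beta c a d : M) : Prop :=
  le a c /\
  exists w : M,
    entry w a d /\
    (exists x y, entry alpha c x /\ entry beta c y /\
       entry w c (cAnd x y)) /\
    (forall i, le a i -> lt i c ->
       exists x y z, entry alpha i x /\ entry beta i y /\
         entry w (succ i) z /\ entry w i (stopStep x y z)).

(** [TrueAt T s i]: the [i]-th entry of [s] is true. *)
Definition TrueAt {M : structure} (T : M -> Prop) (s i : M) : Prop :=
  exists p, entry s i p /\ T p.

(* Main.v *)
(* A disjunction with stopping condition is equivalent, step by step, to the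
   next one as long as the stopping condition is false, and to [beta_i] as soon
   as it is true.  Since [k0] is standard, unfolding [k0] steps is an external
   induction, which does not need induction for formulas containing [T].  What
   has to be done inside [M] is arithmetical: the disjunctions exist, are unique
   and are sentences, by induction on the distance to [c].  This rests on
   Goedel's beta function: any arithmetical function restricted to an initial
   segment of [M] is coded, by the Chinese remainder theorem. *)

From Stdlib Require Import Arith Lia List Classical Ring.
Require Import Defs.
Import ListNotations.
Local Open Scope pa_scope.

(** * Predicates definable in [M] with parameters, closed under the logical operations *)

Section Definability.
Local Set Implicit Arguments.
Context {M : structure}.
Implicit Types (e : nat -> M) (P Q : (nat -> M) -> Prop).

Definition scons (x : M) e : nat -> M :=
  fun n => match n with 0%nat => x | S n => e n end.
Definition tail e : nat -> M := fun n => e (S n).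

(* The parameters [L] are stored in the first variables, followed by the
   de Bruijn context [e], cut off at depth [n] and read as levels. *)
Definition fits (L : list M) (n : nat) e e' : Prop :=
  (forall j x, nth_error L j = Some x -> e' j = x) /\
  (forall i, i < n -> e' (length L + (n - 1 - i))%nat = e i).

Definition aterm (f : (nat -> M) -> M) : Prop :=
  exists L0 n0, forall L n, incl L0 L -> n0 <= n ->
  exists t, forall e e', fits L n e e' -> eval e' t = f e.

(* [P] is arithmetical with parameters.  Quantifying over all large enough
   parameter lists and depths makes the connectives combine without any
   renaming of variables. *)
Definition arith P : Prop :=
  exists L0 n0, forall L n, incl L0 L -> n0 <= n ->
  exists p, forall e e', fits L n e e' -> (sat e' p <-> P e).

Lemma at_cst (m : M) : aterm (fun _ => m).
Proof.
exists [m], 0; intros L n HL _.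
(* The constant is a parameter; its position in [L] is the variable that denotes it. *)
destruct (In_nth_error L m (HL m (or_introl eq_refl))) as [j Hj].
exists (tVar j); intros e e' [H _]; exact (H j m Hj).
Qed.

Lemma at_var (i : nat) : aterm (fun e => e i).
Proof.
exists [], (S i); intros L n _ Hn.
exists (tVar (length L + (n - 1 - i))); intros e e' [_ H]; apply H; lia.
Qed.

Lemma at_tail f : aterm f -> aterm (fun e => f (tail e)).
Proof.
intros (L0 & n0 & H); exists L0, (S n0); intros L n HL Hn.
(* Levels do not shift: index [S i] at depth [n] and index [i] at depth [n - 1] are the same
   variable, so the same term serves. *)
destruct (H L (n - 1) HL ltac:(lia)) as [t Ht].
exists t; intros e e' [H1 H2]; apply Ht; split; [exact H1|].
intros i Hi; unfold tail; rewrite <- H2 by lia; f_equal; lia.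
Qed.

Lemma at_succ f : aterm f -> aterm (fun e => succ (f e)).
Proof.
intros (L0 & n0 & H); exists L0, n0; intros L n HL Hn.
destruct (H L n HL Hn) as [t Ht].
exists (tSucc t); intros e e' He; simpl; now rewrite (Ht e).
Qed.

(** Concatenating the parameter lists and adding the depths passes both thresholds, so two formulas
    can share one variable layout. *)
Lemma common_bound (A B : list M -> nat -> Prop) :
  (exists L0 n0, forall L n, incl L0 L -> n0 <= n -> A L n) ->
  (exists L0 n0, forall L n, incl L0 L -> n0 <= n -> B L n) ->
  exists L0 n0, forall L n, incl L0 L -> n0 <= n -> A L n /\ B L n.
Proof.
intros (L1 & n1 & H1) (L2 & n2 & H2); exists (L1 ++ L2), (n1 + n2)%nat.
intros L n HL Hn; split; [apply H1|apply H2]; try lia;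
  intros x Hx; apply HL, in_or_app; auto.
Qed.

Lemma at_add f g : aterm f -> aterm g -> aterm (fun e => f e + g e).
Proof.
intros Hf Hg; destruct (common_bound _ _ Hf Hg) as (L0 & n0 & H).
exists L0, n0; intros L n HL Hn.
destruct (H L n HL Hn) as [[t Ht] [u Hu]].
exists (tAdd t u); intros e e' He; simpl; now rewrite (Ht e), (Hu e).
Qed.

Lemma at_mul f g : aterm f -> aterm g -> aterm (fun e => f e * g e).
Proof.
intros Hf Hg; destruct (common_bound _ _ Hf Hg) as (L0 & n0 & H).
exists L0, n0; intros L n HL Hn.
destruct (H L n HL Hn) as [[t Ht] [u Hu]].
exists (tMul t u); intros e e' He; simpl; now rewrite (Ht e), (Hu e).
Qed.

Lemma at_pair f g : aterm f -> aterm g -> aterm (fun e => pair (f e) (g e)).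
Proof. intros Hf Hg; unfold pair; auto using at_add, at_mul. Qed.

Lemma ar_iff P Q : (forall e, Q e <-> P e) -> arith P -> arith Q.
Proof.
intros HPQ (L0 & n0 & H); exists L0, n0; intros L n HL Hn.
destruct (H L n HL Hn) as [p Hp].
exists p; intros e e' He; rewrite HPQ; auto.
Qed.

Lemma ar_eq f g : aterm f -> aterm g -> arith (fun e => f e = g e).
Proof.
intros Hf Hg; destruct (common_bound _ _ Hf Hg) as (L0 & n0 & H).
exists L0, n0; intros L n HL Hn.
destruct (H L n HL Hn) as [[t Ht] [u Hu]].
exists (fEq t u); intros e e' He; simpl; now rewrite (Ht e), (Hu e).
Qed.

Lemma ar_not P : arith P -> arith (fun e => ~ P e).
Proof.
intros (L0 & n0 & H); exists L0, n0; intros L n HL Hn.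
destruct (H L n HL Hn) as [p Hp].
exists (fNot p); intros e e' He; simpl; now rewrite (Hp e).
Qed.

Lemma ar_or P Q : arith P -> arith Q -> arith (fun e => P e \/ Q e).
Proof.
intros HP HQ; destruct (common_bound _ _ HP HQ) as (L0 & n0 & H).
exists L0, n0; intros L n HL Hn.
destruct (H L n HL Hn) as [[p Hp] [q Hq]].
exists (fOr p q); intros e e' He; simpl; now rewrite (Hp e), (Hq e).
Qed.

Lemma ar_ex (P : (nat -> M) -> M -> Prop) :
  arith (fun e => P (tail e) (e 0)) -> arith (fun e => exists x, P e x).
Proof.
intros (L0 & n0 & H); exists L0, n0; intros L n HL Hn.
destruct (H L (S n) HL ltac:(lia)) as [p Hp].
exists (fEx (length L + n) p); intros e e' [H1 H2]; simpl.
assert (Hx : forall x, sat (upd e' (length L + n) x) p <-> P e x).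
{ intros x; apply (Hp (scons x e)); split.
  - intros j y Hj; unfold upd; rewrite (proj2 (Nat.eqb_neq _ _)); auto.
    enough (j < length L) by lia; apply nth_error_Some; congruence.
  - intros [|i] Hi; unfold upd.
    + now rewrite (proj2 (Nat.eqb_eq _ _)) by lia.
    + rewrite (proj2 (Nat.eqb_neq _ _)) by lia; simpl.
      rewrite <- H2 by lia; f_equal; lia. }
split; intros [x Hx']; exists x; now apply Hx.
Qed.

Lemma ar_and P Q : arith P -> arith Q -> arith (fun e => P e /\ Q e).
Proof.
intros HP HQ; apply ar_iff with (fun e => ~ (~ P e \/ ~ Q e)).
- intros e; tauto.
- auto using ar_not, ar_or.
Qed.

Lemma ar_imp P Q : arith P -> arith Q -> arith (fun e => P e -> Q e).
Proof.
intros HP HQ; apply ar_iff with (fun e => ~ P e \/ Q e).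
- intros e; tauto.
- auto using ar_not, ar_or.
Qed.

Lemma ar_all (P : (nat -> M) -> M -> Prop) :
  arith (fun e => P (tail e) (e 0)) -> arith (fun e => forall x, P e x).
Proof.
intros HP; apply ar_iff with (fun e => ~ exists x, ~ P e x).
- intros e; split; [intros H [x Hx]; auto|].
  intros H x; apply NNPP; eauto.
- apply ar_not, ar_ex, ar_not, HP.
Qed.

(** Naming the values of [f] and [g] by quantified variables replaces substitution into the formula
    for [P]. The quantifiers come in reverse order, so that [x] gets index 0 and [y] index 1. *)
Lemma ar_comp2 (P : M -> M -> Prop) f g :
  arith (fun e => P (e 0) (e 1)) -> aterm f -> aterm g ->
  arith (fun e => P (f e) (g e)).
Proof.
intros HP Hf Hg.
apply ar_iff with (fun e => exists y x, x = f e /\ y = g e /\ P x y).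
- intros e; split; [eauto 6|now intros (x & y & -> & -> & H)].
- apply ar_ex, ar_ex, ar_and; [apply ar_eq|apply ar_and; [apply ar_eq|]].
  + apply at_var.
  + exact (at_tail (at_tail Hf)).
  + apply (at_var 1).
  + exact (at_tail (at_tail Hg)).
  + exact HP.
Qed.

Lemma ar_comp3 (P : M -> M -> M -> Prop) f g h :
  arith (fun e => P (e 0) (e 1) (e 2)) -> aterm f -> aterm g -> aterm h ->
  arith (fun e => P (f e) (g e) (h e)).
Proof.
intros HP Hf Hg Hh.
apply ar_iff with
  (fun e => exists z y x, x = f e /\ y = g e /\ z = h e /\ P x y z).
- intros e; split; [eauto 8|now intros (x & y & z & -> & -> & -> & H)].
- apply ar_ex, ar_ex, ar_ex, ar_and;
    [apply ar_eq|apply ar_and; [apply ar_eq|apply ar_and; [apply ar_eq|]]].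
  + apply at_var.
  + exact (at_tail (at_tail (at_tail Hf))).
  + apply (at_var 1).
  + exact (at_tail (at_tail (at_tail Hg))).
  + apply (at_var 2).
  + exact (at_tail (at_tail (at_tail Hh))).
  + exact HP.
Qed.

End Definability.

(** * Automation for proving that a predicate is arithmetical *)

Ltac arith_term :=
  repeat first [apply at_cst | apply at_succ | apply at_pair
               | apply at_add | apply at_mul
               | cbv beta delta [tail]; apply at_var ].

Ltac arith_step tac :=
  cbv beta;
  first [ tac | apply ar_eq; arith_term
        | apply ar_ex | apply ar_and | apply ar_or
        | apply ar_not | apply ar_imp | apply ar_all ].

Ltac arith0 := repeat arith_step fail.

Lemma ar_le {M : structure} (f g : (nat -> M) -> M) :
  aterm f -> aterm g -> arith (fun e => le (f e) (g e)).
Proof. apply (@ar_comp2 M le); unfold le; arith0. Qed.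

Lemma ar_lt {M : structure} (f g : (nat -> M) -> M) :
  aterm f -> aterm g -> arith (fun e => lt (f e) (g e)).
Proof. apply (@ar_comp2 M lt); unfold lt, le; arith0. Qed.

Lemma ar_entry {M : structure} (f g h : (nat -> M) -> M) :
  aterm f -> aterm g -> aterm h ->
  arith (fun e => entry (f e) (g e) (h e)).
Proof. apply (@ar_comp3 M entry); unfold entry, lt, le; arith0. Qed.

(** The last alternative treats a binary predicate whose arithmeticity is a hypothesis in the
    context; this is why [StopDisj_arith] is posed before the inductions that mention [StopDisj]. *)
Ltac arith :=
  repeat arith_step ltac:(first
    [ apply ar_le; arith_term
    | apply ar_lt; arith_term
    | apply ar_entry; arith_term
    | match goal with H : arith (fun e => ?P (e 0) (e 1)) |- _ =>
        apply (@ar_comp2 _ P); [exact H|arith_term|arith_term]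
      end ]).

(** * Induction, semiring laws and order in a model of PA *)

Section Arithmetic.
Context {M : structure}.
Hypothesis HM : PA M.
Local Set Implicit Arguments.
Implicit Types a b c d i j k m n p q u v w x y z : M.

Lemma ind (P : M -> Prop) :
  arith (fun e => P (e 0)) -> P zero -> (forall x, P x -> P (succ x)) ->
  forall x, P x.
Proof.
intros (L & n0 & H) H0 HS.
destruct (H L (S n0) (incl_refl L) ltac:(lia)) as [p Hp].
(* The valuation lists the parameters and is zero beyond them; [v] is index 0 at depth [S n0], the
   variable on which the induction runs. *)
set (e' := fun j : nat => nth j L (zero : M)).
set (v := (length L + n0)%nat).
assert (Hx : forall x, sat (upd e' v x) p <-> P x).
{ intros x; apply (Hp (scons x (fun _ => zero))); split.
  - intros j y Hj.
    assert (j < length L) by (apply nth_error_Some; congruence).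
    unfold upd; rewrite (proj2 (Nat.eqb_neq _ _)) by (unfold v; lia).
    now apply nth_error_nth.
  - intros [|i] Hi; unfold upd.
    + now rewrite (proj2 (Nat.eqb_eq _ _)) by (unfold v; lia).
    + rewrite (proj2 (Nat.eqb_neq _ _)) by (unfold v; lia).
      apply nth_overflow; lia. }
intros x; apply Hx, (PA_ind HM); [now apply Hx|].
intros y Hy; apply Hx, HS, Hx, Hy.
Qed.

Ltac induct x := pattern x; apply ind; [arith| |]; clear x.

Lemma add_0l x : zero + x = x.
Proof.
induct x; [apply (PA_add0 HM)|intros x IH].
now rewrite (PA_addS HM), IH.
Qed.

Lemma add_Sl x y : succ x + y = succ (x + y).
Proof.
induct y; [now rewrite !(PA_add0 HM)|intros y IH].
now rewrite !(PA_addS HM), IH.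
Qed.

Lemma add_comm x y : x + y = y + x.
Proof.
induct y; [now rewrite (PA_add0 HM), add_0l|intros y IH].
now rewrite (PA_addS HM), add_Sl, IH.
Qed.

Lemma add_assoc x y z : x + (y + z) = x + y + z.
Proof.
induct z; [now rewrite !(PA_add0 HM)|intros z IH].
now rewrite !(PA_addS HM), IH.
Qed.

Lemma mul_0l x : zero * x = zero.
Proof.
induct x; [apply (PA_mul0 HM)|intros x IH].
now rewrite (PA_mulS HM), IH, (PA_add0 HM).
Qed.

Lemma mul_Sl x y : succ x * y = x * y + y.
Proof.
induct y; [now rewrite !(PA_mul0 HM), (PA_add0 HM)|intros y IH].
rewrite !(PA_mulS HM), IH, !(PA_addS HM).
f_equal; rewrite <- !add_assoc; f_equal; apply add_comm.
Qed.

Lemma mul_comm x y : x * y = y * x.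
Proof.
induct y; [now rewrite (PA_mul0 HM), mul_0l|intros y IH].
now rewrite (PA_mulS HM), mul_Sl, IH.
Qed.

Lemma mul_add_l x y z : (x + y) * z = x * z + y * z.
Proof.
induct z; [now rewrite !(PA_mul0 HM), (PA_add0 HM)|intros z IH].
rewrite !(PA_mulS HM), IH, <- !add_assoc; f_equal.
rewrite !add_assoc; f_equal; apply add_comm.
Qed.

Lemma mul_assoc x y z : x * (y * z) = x * y * z.
Proof.
induct z; [now rewrite !(PA_mul0 HM)|intros z IH].
now rewrite !(PA_mulS HM), (mul_comm x), mul_add_l, <- IH, !(mul_comm x).
Qed.

Definition one : M := succ zero.

Lemma PA_semiring : semi_ring_theory zero one add mul (@eq M).
Proof.
split; auto using add_0l, add_comm, add_assoc, mul_0l, mul_comm, mul_assoc, mul_add_l.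
intros x; unfold one; now rewrite mul_Sl, mul_0l, add_0l.
Qed.

Add Ring PA_ring : PA_semiring.

Lemma succ_add1 x : succ x = x + one.
Proof. unfold one; now rewrite (PA_addS HM), (PA_add0 HM). Qed.

Ltac sring := rewrite ?succ_add1; ring.

Lemma zero_or_succ x : x = zero \/ exists y, x = succ y.
Proof. induct x; eauto. Qed.

Lemma add_cancel x y z : z + x = z + y -> x = y.
Proof.
induct z; [now rewrite !add_0l|intros z IH].
rewrite !add_Sl; intros H; apply IH, (PA_succ_inj HM), H.
Qed.

Lemma add_succ_neq x z : x + succ z <> x.
Proof.
intros H; apply (PA_succ_neq0 HM (x := z)), (@add_cancel _ _ x).
rewrite H; ring.
Qed.

Lemma le_refl x : le x x.
Proof. exists zero; ring. Qed.

Lemma le_zero x : le zero x.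
Proof. exists x; ring. Qed.

Lemma le_trans x y z : le x y -> le y z -> le x z.
Proof. intros [u <-] [v <-]; exists (u + v); ring. Qed.

Lemma lt_le x y : lt x y -> le x y.
Proof. intros [u <-]; exists (succ u); sring. Qed.

Lemma lt_le_trans x y z : lt x y -> le y z -> lt x z.
Proof. apply le_trans. Qed.

Lemma le_lt_trans x y z : le x y -> lt y z -> lt x z.
Proof. intros [u <-] [v <-]; exists (u + v); sring. Qed.

Lemma lt_irrefl x : ~ lt x x.
Proof. intros [u H]; apply (@add_succ_neq x u); rewrite <- H at 2; sring. Qed.

Lemma lt_succ x : lt x (succ x).
Proof. apply le_refl. Qed.

Lemma lt_succ_le x y : lt x (succ y) -> le x y.
Proof. intros [u H]; exists u; apply (PA_succ_inj HM); now rewrite <- H, add_Sl. Qed.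

Lemma le_lt_succ x y : le x y -> lt x (succ y).
Proof. intros [u <-]; exists u; now rewrite add_Sl. Qed.

Lemma not_lt_zero x : ~ lt x zero.
Proof. intros [u H]; rewrite add_Sl in H; now apply (PA_succ_neq0 HM) in H. Qed.

Lemma le_or_lt x y : le x y \/ lt y x.
Proof.
induct x; [left; apply le_zero|intros x [[z <-]|H]].
- destruct (zero_or_succ z) as [->|[w ->]].
  + right; exists zero; sring.
  + left; exists w; sring.
- right; exact (le_trans H (lt_le (lt_succ x))).
Qed.

Lemma le_eq_or_lt x y : le x y -> x = y \/ lt x y.
Proof.
intros [z <-]; destruct (zero_or_succ z) as [->|[w ->]].
- left; ring.
- right; exists w; sring.
Qed.

Lemma le_antisym x y : le x y -> le y x -> x = y.
Proof.
intros H1 H2; destruct (le_eq_or_lt H1) as [|H]; auto.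
now destruct (lt_irrefl (lt_le_trans H H2)).
Qed.

(** * Pairing, division with remainder, and entries of coded sequences *)

Lemma pair_inj x y x' y' : pair x y = pair x' y' -> x = x' /\ y = y'.
Proof.
assert (Hlt : forall x y x' y', lt (x + y) (x' + y') -> lt (pair x y) (pair x' y')).
{ clear -HM; intros x y x' y' [z Hz]; unfold pair; rewrite <- Hz.
  (* This is the difference of the two pairs less one, expanded for [x' + y' = x + y + 1 + z] so
     that no subtraction remains. *)
  exists (x + y + y + z * (one + one) * (x + y) + z * (one + one) + z * z + x').
  sring. }
intros H; destruct (le_or_lt (x + y) (x' + y')) as [H1|H1].
- destruct (le_eq_or_lt H1) as [H2|H2].
  + assert (x = x') as <-
      by (unfold pair in H; rewrite H2 in H; now apply add_cancel in H).
    split; [auto|now apply add_cancel in H2].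
  + apply Hlt in H2; rewrite H in H2; now apply lt_irrefl in H2.
- apply Hlt in H1; rewrite H in H1; now apply lt_irrefl in H1.
Qed.

Lemma division m a : exists q x, a = q * succ m + x /\ lt x (succ m).
Proof.
induct a.
- exists zero, zero; split; [sring|exists m; sring].
- intros a (q & x & -> & H).
  destruct (le_eq_or_lt (@lt_succ_le _ _ H)) as [->|H'].
  + exists (succ q), zero; split; [sring|exists m; sring].
  + exists q, (succ x); split; [sring|now apply le_lt_succ].
Qed.

Lemma remainder_unique m q x q' x' :
  q * m + x = q' * m + x' -> lt x m -> lt x' m -> x = x'.
Proof.
assert (Hle : forall q x q' x', q * m + x = q' * m + x' -> lt x m ->
                le q q' -> x = x').
{ clear -HM; intros q x q' x' H Hx [d <-].
  assert (E : x = d * m + x')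
    by (apply (@add_cancel _ _ (q * m)); rewrite H; ring).
  destruct (zero_or_succ d) as [->|[w ->]]; [rewrite E; ring|].
  destruct (@lt_irrefl m); apply le_lt_trans with x; auto.
  exists (w * m + x'); rewrite E; sring. }
intros H Hx Hx'; destruct (le_or_lt q q') as [Hq|Hq]; [eauto|].
symmetry; apply (@Hle q' x' q x); auto using lt_le.
Qed.

Lemma entry_unique s i x y : entry s i x -> entry s i y -> x = y.
Proof.
intros (a & b & q & -> & Ha & Hx) (a' & b' & q' & E & Ha' & Hy).
apply pair_inj in E as [<- <-].
apply (@remainder_unique (succ (succ i * b)) q x q' y); congruence.
Qed.

Lemma entry_total s i x j : entry s i x -> exists y, entry s j y.
Proof.
intros (a & b & _ & -> & _).
destruct (division (succ j * b) a) as (q & y & H & Hy).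
exists y, a, b, q; auto.
Qed.

(** * Congruences and invertible residues *)

(* Both multiples are needed, as there is no subtraction. *)
Definition cong m x y : Prop := exists p q, x + p * m = y + q * m.

Lemma cong_refl m x : cong m x x.
Proof. exists zero, zero; ring. Qed.

Lemma cong_sym m x y : cong m x y -> cong m y x.
Proof. intros (p & q & H); exists q, p; auto. Qed.

Lemma cong_trans m x y z : cong m x y -> cong m y z -> cong m x z.
Proof.
intros (p & q & H) (p' & q' & H'); exists (p + p'), (q + q').
transitivity (x + p * m + p' * m); [ring|].
rewrite H; transitivity (y + p' * m + q * m); [ring|].
rewrite H'; ring.
Qed.

Lemma cong_add m x x' y y' :
  cong m x x' -> cong m y y' -> cong m (x + y) (x' + y').
Proof.
intros (p & q & H) (p' & q' & H'); exists (p + p'), (q + q').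
transitivity (x + p * m + (y + p' * m)); [ring|].
rewrite H, H'; ring.
Qed.

Lemma cong_mul m x x' y y' :
  cong m x x' -> cong m y y' -> cong m (x * y) (x' * y').
Proof.
intros (p & q & H) (p' & q' & H').
exists (x * p' + p * y + p * p' * m), (x' * q' + q * y' + q * q' * m).
transitivity ((x + p * m) * (y + p' * m)); [ring|].
rewrite H, H'; ring.
Qed.

Lemma cong_cancel m x y z : cong m (x + z) (y + z) -> cong m x y.
Proof.
intros (p & q & H); exists p, q; apply (@add_cancel _ _ z).
transitivity (x + z + p * m); [ring|]; rewrite H; ring.
Qed.

Lemma cong_multiple m x : cong m (x * m) zero.
Proof. exists zero, x; ring. Qed.

(** A surplus of multiples of [m] on the side of [a] would make [x] at least [m]; hence the surplus
    is on the other side and is the quotient. *)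
Lemma cong_remainder m a x :
  cong m a x -> lt x m -> exists q, a = q * m + x.
Proof.
intros (p & q & H) Hx; destruct (le_or_lt p q) as [[d <-]|[d <-]].
- exists d; apply (@add_cancel _ _ (p * m)).
  transitivity (a + p * m); [ring|]; rewrite H; ring.
- destruct (@lt_irrefl x); apply (lt_le_trans Hx).
  exists (a + d * m); apply (@add_cancel _ _ (q * m)).
  transitivity (x + q * m); [|ring]; rewrite <- H; sring.
Qed.

(* The predecessor of the modulus plays the role of -1. *)
Lemma cong_opp y x : cong (succ y) (y * x + x) zero.
Proof.
replace (y * x + x) with (x * succ y) by sring; apply cong_multiple.
Qed.

(** Coprimality of [x] and [m], in the form that the Chinese remainder theorem uses directly. *)
Definition invertible m x : Prop := exists u, cong m (x * u) one.

Lemma invertible_mul m x y :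
  invertible m x -> invertible m y -> invertible m (x * y).
Proof.
intros [u Hu] [v Hv]; exists (u * v).
replace (x * y * (u * v)) with (x * u * (y * v)) by ring.
replace one with (one * one) by ring; now apply cong_mul.
Qed.

Lemma invertible_factor m x y : invertible m (x * y) -> invertible m x.
Proof.
intros [u Hu]; exists (y * u); now replace (x * (y * u)) with (x * y * u) by ring.
Qed.

Lemma invertible_cong m x y : cong m x y -> invertible m x -> invertible m y.
Proof.
intros H [u Hu]; exists u; apply cong_trans with (x * u); auto.
apply cong_mul; auto using cong_sym, cong_refl.
Qed.

(** Modulo [succ y], [y] is -1 and so its own inverse. *)
Lemma invertible_pred y : invertible (succ y) y.
Proof.
exists y; apply (@cong_cancel _ _ _ y); apply cong_trans with zero.
- apply cong_opp.
- apply cong_sym; replace (one + y) with (one * succ y) by sring.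
  apply cong_multiple.
Qed.

(* The moduli of the beta function are pairwise coprime as soon as all
   differences of indices divide [b]. *)
Lemma invertible_moduli b i j d w :
  succ i + d = j -> b = succ d * w ->
  invertible (succ (succ j * b)) (succ (succ i * b)).
Proof.
intros <- Hw; set (m' := succ (succ i + d) * b).
(* Both [b] and [succ d] are invertible as divisors of invertible elements: [b] divides [m'], which
   is -1, and [succ d] divides [b]. *)
assert (Hb : invertible (succ m') b).
{ apply invertible_factor with (succ (succ i + d)); rewrite mul_comm.
  apply invertible_pred. }
assert (Hd : invertible (succ m') (succ d)).
{ apply invertible_factor with w; now rewrite <- Hw. }
(* The two moduli differ by [succ d * b], so the smaller one is congruent to -(d + 1) b modulo the
   larger. *)
apply invertible_cong with (m' * (succ d * b)).
- apply (@cong_cancel _ _ _ (succ d * b)), cong_trans with zero.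
  + apply cong_opp.
  + apply cong_sym.
    replace (succ (succ i * b) + succ d * b) with (one * succ m')
      by (unfold m'; sring).
    apply cong_multiple.
- auto using invertible_mul, invertible_pred.
Qed.

(** The induction builds [B] times the factorial of [n]. *)
Lemma common_multiple n B :
  exists b, le B b /\ forall d, lt d n -> exists w, b = succ d * w.
Proof.
induct n.
- exists B; split; [apply le_refl|intros d H; now apply not_lt_zero in H].
- intros n (b & HB & Hb); exists (b * succ n); split.
  + apply (le_trans HB); exists (b * n); sring.
  + intros d Hd; apply lt_succ_le, le_eq_or_lt in Hd as [->|Hd].
    * exists b; ring.
    * destruct (Hb d Hd) as [w Hw]; exists (w * succ n); rewrite Hw; ring.
Qed.

(** * Coding arithmetical functions on initial segments by the beta function *)

Section Comprehension.
Variables (P : M -> M -> Prop) (n : M).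
Hypothesis P_arith : arith (fun e => P (e 0) (e 1)).
Hypothesis P_total : forall i, lt i n -> exists x, P i x.
Hypothesis P_unique : forall i x y, lt i n -> P i x -> P i y -> x = y.

Lemma values_bounded : exists B, forall i x, lt i n -> P i x -> le x B.
Proof.
enough (H : forall k, le k n ->
              exists B, forall i x, lt i k -> P i x -> le x B)
  by exact (H n (le_refl n)).
intros k; induct k.
- intros _; exists zero; intros i x Hi; now apply not_lt_zero in Hi.
- intros k IH Hk; destruct (IH (lt_le Hk)) as [B HB].
  destruct (P_total Hk) as [y Hy]; exists (B + y); intros i x Hi Hx.
  apply lt_succ_le, le_eq_or_lt in Hi as [->|Hi].
  + rewrite (P_unique Hk Hx Hy); exists B; ring.
  + apply le_trans with B; [eauto|now exists y].
Qed.

(** [Q] stands for the product of the first [k] moduli, known only through its residues: it vanishes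
    modulo these and is invertible modulo the later ones. Adding a multiple of [Q] thus corrects the
    next residue and keeps the earlier ones. *)
Lemma chinese_remainder b k :
  (forall d, lt d n -> exists w, b = succ d * w) ->
  le k n ->
  exists a Q,
    (forall i x, lt i k -> P i x -> cong (succ (succ i * b)) a x) /\
    (forall i, lt i k -> cong (succ (succ i * b)) Q zero) /\
    (forall j, le k j -> lt j n -> invertible (succ (succ j * b)) Q).
Proof.
intros Hb; pattern k; apply ind; [unfold invertible, cong; arith| |]; clear k.
- intros _; exists zero, one; repeat split.
  + intros i x Hi; now apply not_lt_zero in Hi.
  + intros i Hi; now apply not_lt_zero in Hi.
  + intros j _ _; exists one; replace (one * one) with one by ring.
    apply cong_refl.
- intros k IH Hk; destruct (IH (lt_le Hk)) as (a & Q & Ha & HQ & HQ').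
  destruct (P_total Hk) as [y Hy].
  destruct (HQ' k (le_refl k) Hk) as [u Hu].
  set (m' := succ k * b) in *.
  (* Modulo [succ m'], [u] inverts [Q] and [m'] is -1, so the added term is [y] minus [a]. *)
  exists (a + Q * (u * (y + m' * a))), (Q * succ m'); repeat split.
  + intros i x Hi Hx; apply lt_succ_le, le_eq_or_lt in Hi as [->|Hi].
    * rewrite (P_unique Hk Hx Hy); fold m'.
      apply cong_trans with (a + one * (y + m' * a)).
      -- apply cong_add; [apply cong_refl|].
         replace (Q * (u * (y + m' * a))) with (Q * u * (y + m' * a)) by ring.
         apply cong_mul; auto using cong_refl.
      -- replace (a + one * (y + m' * a)) with (m' * a + a + y) by ring.
         replace y with (zero + y) at 2 by ring.
         apply cong_add; [apply cong_opp|apply cong_refl].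
    * replace x with (x + zero * (u * (y + m' * a))) by ring.
      apply cong_add; [now apply Ha|]; apply cong_mul; auto using cong_refl.
  + intros i Hi; apply lt_succ_le, le_eq_or_lt in Hi as [->|Hi].
    * apply cong_multiple.
    * replace zero with (zero * succ m') by ring.
      apply cong_mul; auto using cong_refl.
  + intros j Hkj Hj; apply invertible_mul; [now apply HQ'; [apply lt_le|]|].
    destruct Hkj as [d Hd].
    destruct (Hb d) as [w Hw].
    { apply le_lt_trans with j; [exists (succ k); now rewrite add_comm|auto]. }
    exact (@invertible_moduli _ _ _ _ _ Hd Hw).
Qed.

(** Divisibility of [b] by 1, ..., [n] makes the moduli coprime, and [b] bounding all values makes
    each value smaller than its modulus, hence equal to the remainder. *)
Lemma comprehension :
  exists s, forall i x, lt i n -> (entry s i x <-> P i x).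
Proof.
destruct values_bounded as [B HB].
destruct (common_multiple n B) as (b & HBb & Hb).
destruct (chinese_remainder Hb (le_refl n)) as (a & Q & Ha & _).
assert (HP : forall i x, lt i n -> P i x -> entry (pair a b) i x).
{ intros i x Hi Hx; exists a, b.
  assert (Hlt : lt x (succ (succ i * b))).
  { apply le_lt_succ, le_trans with b; [exact (le_trans (HB i x Hi Hx) HBb)|].
    exists (i * b); sring. }
  destruct (cong_remainder (Ha i x Hi Hx) Hlt) as [q Hq]; eauto. }
exists (pair a b); intros i x Hi; split; [|now apply HP].
intros Hx; destruct (P_total Hi) as [y Hy].
now rewrite (entry_unique Hx (HP i y Hi Hy)).
Qed.

End Comprehension.

(** * Inversion and composition of coded derivations *)

Section Derivations.
Variable Step : (M -> Prop) -> M -> Prop.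
Hypothesis Step_mono : forall (R R' : M -> Prop) x,
  (forall z, R z -> R' z) -> Step R x -> Step R' x.

(** Each earlier entry is derived by the same sequence, cut off at its index. *)
Lemma derivable_inv x : derivable Step x -> Step (derivable Step) x.
Proof.
intros (s & n & Hx & H).
apply Step_mono with (2 := H n x (le_refl n) Hx).
intros z (j & Hj & Hz); exists s, j; split; auto.
intros i y Hi; apply H, le_trans with j; auto using lt_le.
Qed.

(* The two derivations are concatenated and [x] is put at the end. *)
Lemma derivable_step p q x :
  derivable Step p -> derivable Step q -> Step (fun z => z = p \/ z = q) x ->
  derivable Step x.
Proof.
intros (s & n & Hp & H) (s' & n' & Hq & H') Hx.
(* The first derivation occupies the indices up to [n], the second is shifted by [succ n], and
   [last] is the first index after both. *)
set (last := succ n + succ n').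
set (P := fun i y =>
  (le i n /\ entry s i y) \/
  (exists j, le j n' /\ i = succ n + j /\ entry s' j y) \/
  (i = last /\ y = x)).
assert (not_le : forall j, ~ le (succ n + j) n)
  by (intros j [d Hd]; apply (@add_succ_neq n (j + d));
    transitivity (succ n + j + d); [sring|exact Hd]).
assert (not_last : forall j, le j n' -> succ n + j <> last).
{ intros j Hj E; apply add_cancel in E; subst j; now apply lt_irrefl in Hj. }
assert (HP : exists w, forall i y, lt i (succ last) -> (entry w i y <-> P i y)).
{ apply comprehension.
  - unfold P; arith.
  - intros i Hi; apply lt_succ_le in Hi.
    destruct (le_or_lt i n) as [Hn|[j <-]].
    { destruct (entry_total i Hp) as [y Hy]; exists y; left; auto. }
    destruct (le_or_lt j n') as [Hj|Hj].
    { destruct (entry_total j Hq) as [y Hy]; exists y; right; left; eauto. }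
    exists x; right; right; split; auto; apply le_antisym.
    + exact Hi.
    + destruct Hj as [d <-]; exists d; unfold last; sring.
  - intros i y z _ [[Hi Hy]|[(j & Hj & -> & Hy)|[-> ->]]]
      [[Hi' Hz]|[(j' & Hj' & E & Hz)|[E ->]]]; subst; try reflexivity.
    all: try (exfalso; solve [eapply not_le; eassumption | eapply not_last; eauto]).
    + apply (entry_unique Hy Hz).
    + apply add_cancel in E as <-; apply (entry_unique Hy Hz). }
destruct HP as [w Hw].
assert (Hlast : forall i, le i last -> lt i (succ last))
  by (intros; now apply le_lt_succ).
assert (Hl : forall i y, le i n -> entry s i y -> lt i last /\ entry w i y).
{ intros i y Hi Hy.
  assert (lt i last) by (apply le_lt_trans with n; auto; exists (succ n'); reflexivity).
  split; auto; apply Hw; [now apply Hlast, lt_le|left; auto]. }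
assert (Hr : forall j y, le j n' -> entry s' j y ->
               lt (succ n + j) last /\ entry w (succ n + j) y).
{ intros j y Hj Hy.
  assert (lt (succ n + j) last)
    by (destruct Hj as [d <-]; exists d; unfold last; sring).
  split; auto; apply Hw; [now apply Hlast, lt_le|right; left; eauto]. }
exists w, last; split; [apply Hw; [apply lt_succ|right; right; auto]|].
intros i y Hi Hy; apply Hw in Hy; auto.
destruct Hy as [[Hin Hy]|[(j & Hj & -> & Hy)|[-> ->]]].
- apply Step_mono with (2 := H i y Hin Hy); intros z (k & Hk & Hz).
  exists k; split; auto; apply Hl; auto.
  apply le_trans with i; auto using lt_le.
- apply Step_mono with (2 := H' j y Hj Hy); intros z (k & Hk & Hz).
  exists (succ n + k); split.
  + destruct Hk as [d <-]; exists d; sring.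
  + apply Hr; auto; apply le_trans with j; auto using lt_le.
- apply Step_mono with (2 := Hx); intros z [-> | ->].
  + exists n; apply Hl; auto using le_refl.
  + exists (succ n + n'); apply Hr; auto using le_refl.
Qed.

End Derivations.

(** * Codes of formulas and closure properties of sentences *)

Lemma std_inj (r s : nat) : std r = (std s : M) -> r = s.
Proof.
revert s; induction r as [|r IH]; intros [|s]; simpl; intros H; auto.
- now apply eq_sym, (PA_succ_neq0 HM) in H.
- now apply (PA_succ_neq0 HM) in H.
- apply (PA_succ_inj HM) in H; auto.
Qed.

(** Takes apart equations between codes; clauses with different constructor tags vanish, since the
    tags are distinct standard numbers. *)
Ltac codes :=
  repeat match goal with
  | H : _ \/ _ |- _ => destruct H
  | H : exists _, _ |- _ => destruct H
  | H : _ /\ _ |- _ => destruct H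
  | H : pair _ _ = pair _ _ |- _ => apply pair_inj in H as [? ?]
  | H : std _ = std _ |- _ => apply std_inj in H; try discriminate H; clear H
  end; subst.

Ltac step_mono := intros ? ? ? ? ?; codes; eauto 10.

Lemma Form_not p : Form p -> Form (cNot p).
Proof.
(* A rule with one premise uses that premise twice. *)
intros H; apply derivable_step with p p; auto; [step_mono|eauto 10].
Qed.

Lemma Form_or p q : Form p -> Form q -> Form (cOr p q).
Proof.
intros Hp Hq; apply derivable_step with p q; auto; [step_mono|].
right; right; left; eauto 10.
Qed.

Lemma Free_not v p : Free v (cNot p) -> Free v p.
Proof.
intros H; apply derivable_inv in H; [|step_mono].
unfold cNot, cEq, cOr, cEx in H; codes; auto.
Qed.

Lemma Free_or v p q : Free v (cOr p q) -> Free v p \/ Free v q.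
Proof.
intros H; apply derivable_inv in H; [|step_mono].
unfold cNot, cEq, cOr, cEx in H; codes; auto.
Qed.

Lemma Sent_not p : Sent p -> Sent (cNot p).
Proof.
intros [Hp Hv]; split; [now apply Form_not|].
intros v H; exact (Hv v (@Free_not _ _ H)).
Qed.

Lemma Sent_or p q : Sent p -> Sent q -> Sent (cOr p q).
Proof.
intros [Hp Hv] [Hq Hw]; split; [now apply Form_or|].
intros v H; destruct (@Free_or _ _ _ H); [eapply Hv|eapply Hw]; eauto.
Qed.

Lemma Sent_and p q : Sent p -> Sent q -> Sent (cAnd p q).
Proof. intros; unfold cAnd; auto using Sent_not, Sent_or. Qed.

Lemma Sent_imp p q : Sent p -> Sent q -> Sent (cImp p q).
Proof. intros; unfold cImp; auto using Sent_not, Sent_or. Qed.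

Lemma Sent_stopStep p q d : Sent p -> Sent q -> Sent d -> Sent (stopStep p q d).
Proof. intros; unfold stopStep; auto using Sent_and, Sent_imp, Sent_or, Sent_not. Qed.

(** * Disjunctions with stopping condition and their truth *)

Section StopDisjunctions.
Variables (T : M -> Prop) (alpha beta c : M).
Hypothesis HT : CTminus T.
Hypothesis alpha_sent : SentSeq c alpha.
Hypothesis beta_sent : SentSeq c beta.

Lemma T_and p q : Sent p -> Sent q -> (T (cAnd p q) <-> T p /\ T q).
Proof.
intros Hp Hq; unfold cAnd.
rewrite (CT_not HT), (CT_or HT), !(CT_not HT); auto using Sent_not, Sent_or; tauto.
Qed.

Lemma T_imp p q : Sent p -> Sent q -> (T (cImp p q) <-> (T p -> T q)).
Proof.
intros Hp Hq; unfold cImp.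
rewrite (CT_or HT), !(CT_not HT); auto using Sent_not; tauto.
Qed.

Lemma T_stopStep p q d : Sent p -> Sent q -> Sent d ->
  (T (stopStep p q d) <-> (T p -> T q) /\ (T p /\ T q \/ ~ T p /\ T d)).
Proof.
intros Hp Hq Hd; unfold stopStep.
rewrite T_and, T_imp, (CT_or HT), !T_and, (CT_not HT);
  auto using Sent_and, Sent_imp, Sent_or, Sent_not; tauto.
Qed.

Lemma TrueAt_entry s i p : entry s i p -> (TrueAt T s i <-> T p).
Proof.
intros Hp; split; [|intros H; exists p; auto].
now intros (q & Hq & H); rewrite (entry_unique Hp Hq).
Qed.

Lemma Sent_entry s i p : SentSeq c s -> le i c -> entry s i p -> Sent p.
Proof.
intros Hs Hi Hp; destruct (Hs i Hi) as (q & Hq & H).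
now rewrite (entry_unique Hp Hq).
Qed.

(** Being a sentence of [M], unlike being true, may be proved by induction inside [M]. *)
Lemma Sent_arith : arith (fun e => @Sent M (e 0)).
Proof.
unfold Sent, Form, Free, Term, Occurs, derivable, cVar, cZero, cSucc, cAdd,
  cMul, cEq, cNot, cOr, cEx.
arith.
Qed.

Lemma StopDisj_arith : arith (fun e => StopDisj alpha beta c (e 0) (e 1)).
Proof. unfold StopDisj, stopStep, cAnd, cImp, cOr, cNot; arith. Qed.

Lemma StopDisj_last d : StopDisj alpha beta c c d ->
  exists x y, entry alpha c x /\ entry beta c y /\ d = cAnd x y.
Proof.
intros (_ & w & Hd & (x & y & Hx & Hy & Hw) & _).
exists x, y; repeat split; auto; apply (entry_unique Hd Hw).
Qed.

Lemma StopDisj_step a d : lt a c -> StopDisj alpha beta c a d ->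
  exists x y z, entry alpha a x /\ entry beta a y /\
    StopDisj alpha beta c (succ a) z /\ d = stopStep x y z.
Proof.
intros Ha (_ & w & Hd & Hc & Hw).
destruct (Hw a (le_refl a) Ha) as (x & y & z & Hx & Hy & Hz & H).
exists x, y, z; repeat split; auto.
- exists w; repeat split; auto.
  intros i Hi; apply Hw; exact (lt_le Hi).
- apply (entry_unique Hd H).
Qed.

(** The recursion runs backward from [c], so the induction is on the distance [j], for all [a] at
    once. *)
Lemma StopDisj_exists j a : a + j = c -> exists d, StopDisj alpha beta c a d.
Proof.
pose proof StopDisj_arith as HS; revert a; induct j.
- intros a Ha; assert (a = c) as -> by (rewrite <- Ha; ring).
  destruct (alpha_sent (le_refl c)) as (x & Hx & _).
  destruct (beta_sent (le_refl c)) as (y & Hy & _).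
  (* A constant sequence suffices: only its entry at [c] is inspected. *)
  destruct (@comprehension (fun i z => z = cAnd x y) (succ c)) as [w Hw];
    [arith|eauto|congruence|].
  exists (cAnd x y); split; [apply le_refl|exists w; repeat split].
  + apply Hw; [apply lt_succ|auto].
  + exists x, y; repeat split; auto; apply Hw; [apply lt_succ|auto].
  + intros i H1 H2; destruct (lt_irrefl (le_lt_trans H1 H2)).
- intros j IH a Ha.
  destruct (IH (succ a)) as [d' (_ & w & Hd' & Hc & Hw)]; [rewrite <- Ha; sring|].
  assert (Hac : lt a c) by (exists j; rewrite <- Ha; sring).
  destruct (alpha_sent (lt_le Hac)) as (x & Hx & _).
  destruct (beta_sent (lt_le Hac)) as (y & Hy & _).
  (* The new witness is [w] with its entry at [a] overwritten. *)
  destruct (@comprehension (fun i z =>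
      i = a /\ z = stopStep x y d' \/ i <> a /\ entry w i z) (succ c)) as [w' Hw'].
  + arith.
  + intros i _; destruct (classic (i = a)); [eauto|].
    destruct (entry_total i Hd') as [z Hz]; eauto.
  + intros i u v _ [[Hi ->]|[Hi Hu]] [[Hi' ->]|[Hi' Hv]]; try easy.
    apply (entry_unique Hu Hv).
  + assert (Hne : forall i, lt a i -> i <> a).
    { intros i Hi ->; now apply lt_irrefl in Hi. }
    assert (Ew : forall i z, lt a i -> le i c -> entry w i z -> entry w' i z).
    { intros i z Hi Hic Hz; apply Hw'; [now apply le_lt_succ|auto]. }
    exists (stopStep x y d'); split; [now apply lt_le|].
    assert (Ha' : entry w' a (stopStep x y d')).
    { apply Hw'; [now apply le_lt_succ, lt_le|auto]. }
    exists w'; repeat split; auto.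
    * destruct Hc as (u & v & Hu & Hv & H); exists u, v; repeat split; auto.
      apply Ew; auto using le_refl.
    * intros i Hi Hic; destruct (le_eq_or_lt Hi) as [<-|Hlt].
      -- exists x, y, d'; repeat split; auto; apply Ew; auto using lt_succ.
      -- destruct (Hw i Hlt Hic) as (u & v & z & Hu & Hv & Hz & H).
         exists u, v, z; repeat split; auto; apply Ew; auto using lt_le.
         exact (lt_le_trans Hlt (lt_le (lt_succ i))).
Qed.

Lemma StopDisj_unique j a d d' : a + j = c ->
  StopDisj alpha beta c a d -> StopDisj alpha beta c a d' -> d = d'.
Proof.
pose proof StopDisj_arith as HS; revert a d d'; induct j.
- intros a d d' Ha; assert (a = c) as -> by (rewrite <- Ha; ring); intros H H'.
  apply StopDisj_last in H as (x & y & Hx & Hy & ->).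
  apply StopDisj_last in H' as (x' & y' & Hx' & Hy' & ->).
  now rewrite (entry_unique Hx Hx'), (entry_unique Hy Hy').
- intros j IH a d d' Ha H H'.
  assert (Hac : lt a c) by (exists j; rewrite <- Ha; sring).
  apply (StopDisj_step Hac) in H as (x & y & z & Hx & Hy & Hz & ->).
  apply (StopDisj_step Hac) in H' as (x' & y' & z' & Hx' & Hy' & Hz' & ->).
  rewrite (entry_unique Hx Hx'), (entry_unique Hy Hy'), (IH (succ a) z z'); auto.
  rewrite <- Ha; sring.
Qed.

(** The truth clauses speak of sentences only, so a disjunction of possibly nonstandard length must
    be a sentence before they apply to it. *)
Lemma StopDisj_Sent j a d : a + j = c -> StopDisj alpha beta c a d -> Sent d.
Proof.
pose proof StopDisj_arith as HS; pose proof Sent_arith as HS'; revert a d; induct j.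
- intros a d Ha; assert (a = c) as -> by (rewrite <- Ha; ring); intros H.
  apply StopDisj_last in H as (x & y & Hx & Hy & ->).
  apply Sent_and; eauto using Sent_entry, le_refl.
- intros j IH a d Ha H.
  assert (Hac : lt a c) by (exists j; rewrite <- Ha; sring).
  apply (StopDisj_step Hac) in H as (x & y & z & Hx & Hy & Hz & ->).
  apply Sent_stopStep; eauto using Sent_entry, lt_le.
  apply (IH (succ a)); auto; rewrite <- Ha; sring.
Qed.

(* [T] may not occur in induction inside [M], but [k] is standard. *)
Lemma T_StopDisj (k : nat) a d :
  le (a + std k) c -> StopDisj alpha beta c a d ->
  TrueAt T alpha (a + std k) ->
  (forall i, le a i -> lt i (a + std k) -> ~ TrueAt T alpha i) ->
  (T d <-> TrueAt T beta (a + std k)).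
Proof.
revert a d; induction k as [|k IH]; intros a d Hac Hd Ht Hf.
- change (std 0) with (zero : M) in *; rewrite (PA_add0 HM) in *.
  (* The true condition is at [a] itself. At [a = c] the disjunction is a plain conjunction;
     otherwise the truth of [x] rules out the continuation, and the step reduces to [y]. *)
  destruct (le_eq_or_lt Hac) as [->|Hlt].
  + apply StopDisj_last in Hd as (x & y & Hx & Hy & ->).
    rewrite (TrueAt_entry Hy); rewrite (TrueAt_entry Hx) in Ht.
    rewrite T_and; eauto using Sent_entry; tauto.
  + apply (StopDisj_step Hlt) in Hd as (x & y & z & Hx & Hy & Hz & ->).
    rewrite (TrueAt_entry Hy); rewrite (TrueAt_entry Hx) in Ht.
    destruct Hlt as [j Hj].
    rewrite T_stopStep; eauto using Sent_entry, StopDisj_Sent; tauto.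
(* One unit moves from the standard distance to the starting index, so the hypothesis for [k]
   applies at [succ a]. *)
- assert (E : a + std (S k) = succ a + std k) by (simpl; sring).
  rewrite E in *.
  assert (Hlt : lt a c) by (apply le_trans with (2 := Hac); now exists (std k)).
  apply (StopDisj_step Hlt) in Hd as (x & y & z & Hx & Hy & Hz & ->).
  rewrite <- (IH (succ a) z); auto.
  + assert (Hxf : ~ T x).
    { rewrite <- (TrueAt_entry Hx); apply Hf; [apply le_refl|now exists (std k)]. }
    assert (Hle := lt_le Hlt); destruct Hlt as [j Hj].
    (* With [x] false, the implication holds vacuously and only the continuation [z] is left. *)
    rewrite T_stopStep; eauto using Sent_entry, StopDisj_Sent; tauto.
  + intros i Hi; apply Hf; exact (lt_le Hi).
Qed.

End StopDisjunctions.
End Arithmetic.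

(** The disjunction is given by a relation on [M], so its existence and uniqueness are part of the
    conclusion. *)
Theorem theorem3p3 (M : structure) (T : M -> Prop) (c alpha beta : M) (k0 : nat) :
  CTminus T ->
  SentSeq c alpha ->
  SentSeq c beta ->
  (* std k0 is the least index of a true alpha_i *)
  le (std k0) c ->
  TrueAt T alpha (std k0) ->
  (forall i : M, lt i (std k0) -> ~ TrueAt T alpha i) ->
  exists d : M,
    unique (StopDisj alpha beta c zero) d /\
    (T d <-> TrueAt T beta (std k0)).
Proof.
intros HT Ha Hb Hk Ht Hf.
assert (HM : PA M) by exact (CT_PA HT).
(* The disjunction starts at zero, whose distance to [c] is [c]. *)
assert (E : zero + c = c) by now apply add_0l.
destruct (@StopDisj_exists M HM alpha beta c Ha Hb c zero E) as [d Hd].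
exists d; split; [split; auto|].
- intros d' Hd'; exact (@StopDisj_unique M HM alpha beta c c zero d d' E Hd Hd').
- assert (Ek : zero + std k0 = (std k0 : M)) by now apply add_0l.
  rewrite <- Ek; apply T_StopDisj with alpha c; rewrite ?Ek; auto.
Qed.
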